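(* Let $H$ be an infinite-dimensional Hilbert space, let $G$ be a locally compact Hausdorff étale groupoid, and let $\Sigma$ be a twist over $G$. If $C_0(G^{(0)})\cong\ell^\infty(X)$ (as $C^*$-algebras) for some infinite set $X$, then $C_r^*(G,\Sigma)\not\cong B(H)$ (as $C^*$-algebras).
   Context: $B(H)$ is the $C^*$-algebra of all bounded operators on $H$, and $\ell^\infty(X)$ is the $C^*$-algebra of bounded complex functions on the set $X$. A locally compact Hausdorff étale groupoid $G$ is a topological groupoid with locally compact Hausdorff topology whose range and source maps $r,s:G\to G^{(0)}$ are local homeomorphisms; $G^{(0)}$ is its unit space. Write $G^u=r^{-1}(u)$, $G_u=s^{-1}(u)$. A twist over $G$ is a central extension of topological groupoids $G^{(0)}\times\mathbb T\xrightarrow{\iota}\Sigma\xrightarrow{q}G$, where $\mathbb T$ is the unit circle, $\Sigma$ is a locally compact Hausdorff groupoid with unit space identified with $G^{(0)}$, $\iota$ is a homeomorphism onto $q^{-1}(G^{(0)})$, $q$ is a continuous open surjective groupoid homomorphism, $\iota(r(\varsigma),z)\varsigma=\varsigma\,\iota(s(\varsigma),z)=:z\varsigma$ for all $\varsigma\in\Sigma$, $z\in\mathbb T$ (centrality), and $\Sigma\to G$ is a locally trivial principal $\mathbb T$-bundle. $C_c(G,\Sigma)$ is the $*$-algebra of continuous compactly supported functions $f:\Sigma\to\mathbb C$ with $f(z\varsigma)=zf(\varsigma)$ for $z\in\mathbb T$ (sections of the associated line bundle over $G$), with product $(f*g)(\varsigma)=\sum_{q(\tau)\in G^{r(\varsigma)}}f(\tau)g(\tau^{-1}\varsigma)$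 (one representative $\tau\in\Sigma$ for each element of $G^{r(\varsigma)}$) and involution $f^*(\varsigma)=\overline{f(\varsigma^{-1})}$. For $u\in G^{(0)}$, let $\ell^2(G_u,\Sigma_u)$ be the Hilbert space of functions $h:q^{-1}(G_u)\to\mathbb C$ with $h(z\varsigma)=zh(\varsigma)$ and $\sum_{q(\varsigma)\in G_u}|h(\varsigma)|^2<\infty$; the regular representation $\lambda_u$ of $C_c(G,\Sigma)$ on it is $\lambda_u(f)h=f*h$. The reduced twisted groupoid $C^*$-algebra $C_r^*(G,\Sigma)$ is the completion of $C_c(G,\Sigma)$ in the norm $\|f\|_r=\sup_{u\in G^{(0)}}\|\lambda_u(f)\|$. *)

(* Defs.v *)
From HB Require Import structures.
From mathcomp Require Import all_boot all_order all_algebra.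
From mathcomp Require Import all_classical all_reals all_analysis.
From mathcomp Require Import complex sesquilinear.

Set Implicit Arguments.
Unset Strict Implicit.
Unset Printing Implicit Defensive.

Import Order.TTheory GRing.Theory Num.Theory.
Import numFieldNormedType.Exports.

Local Open Scope classical_set_scope.
Local Open Scope ring_scope.
Local Open Scope complex_scope.

(* mathcomp-analysis only puts a topology on the carrier of an abstract field,
   so [R[i]] gets its usual normed-space structure over itself here. *)
HB.instance Definition _ (R : rcfType) :=
  NormedModule.copy R[i] ((R[i] : numFieldType)^o).

(* The norm of a complex normed space lands in [R[i]]; this is its value as a
   real number. *)
Definition rnorm (R : realType) (V : normedModType R[i]) (x : V) : R :=
  complex.Re `|x|.

(* A complex *-algebra given as a subset [elts] of an ambient vector space,
   whose linear structure it inherits.  The product and the involution are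
   total functions on the ambient space, but only their values on [elts]
   are meaningful. *)
Record starAlg (R : realType) := StarAlg {
  ambient : lmodType R[i];
  elts : set ambient;
  smul : ambient -> ambient -> ambient;
  sstar : ambient -> ambient }.
Arguments elts {R} s : rename.
Arguments smul {R s} : rename.
Arguments sstar {R s} : rename.

(* An isomorphism of C*-algebras is a bijective *-homomorphism (it is then
   automatically isometric). *)
Definition star_isomorphism (R : realType) (A B : starAlg R)
    (phi : ambient A -> ambient B) : Prop :=
  [/\ set_bij (elts A) (elts B) phi,
      {in elts A &, forall a b, phi (a + b) = phi a + phi b},
      forall c : R[i], {in elts A, forall a, phi (c *: a) = c *: phi a},
      {in elts A &, forall a b, phi (smul a b) = smul (phi a) (phi b)}
    & {in elts A, forall a, phi (sstar a) = sstar (phi a)}].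

Definition star_isomorphic (R : realType) (A B : starAlg R) : Prop :=
  exists phi : ambient A -> ambient B, star_isomorphism phi.

(* C*-algebras are not assumed unital. *)
HB.mixin Record CompleteNormedModule_isCStarAlgebra (R : realType) A
    of CompleteNormedModule R[i] A := {
  cmul : A -> A -> A;
  cstar : A -> A;
  cmulA : associative cmul;
  cmulDl : left_distributive cmul +%R;
  cmulDr : right_distributive cmul +%R;
  cmulZl : forall (c : R[i]) a b, cmul (c *: a) b = c *: cmul a b;
  cmulZr : forall (c : R[i]) a b, cmul a (c *: b) = c *: cmul a b;
  cstarD : {morph cstar : a b / a + b};
  cstarZ : forall (c : R[i]) a, cstar (c *: a) = Num.conj c *: cstar a;
  cstarM : forall a b, cstar (cmul a b) = cmul (cstar b) (cstar a);
  cstarK : involutive cstar;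
  cnormM : forall a b, `|cmul a b| <= `|a| * `|b|;
  cnorm_star : forall a, `|cmul (cstar a) a| = `|a| ^+ 2 }.

#[short(type="cstarAlgType")]
HB.structure Definition CStarAlgebra (R : realType) :=
  {A of CompleteNormedModule R[i] A & CompleteNormedModule_isCStarAlgebra R A}.

Definition cstar_starAlg (R : realType) (A : cstarAlgType R) : starAlg R :=
  @StarAlg R A setT cmul cstar.

(* The inner product of a complex Hilbert space: a positive definite
   Hermitian form, linear in the first variable, inducing the norm. *)
Definition hilbert_dot (R : realType) (H : completeNormedModType R[i])
    (dot : {dot H for Num.conj}) : Prop :=
  forall x : H, `|x| ^+ 2 = dot x x.

Definition infinite_dimensional (K : numFieldType) (V : lmodType K) : Prop :=
  forall s : seq V, exists x : V,
    forall c : 'I_(size s) -> K, x <> \sum_i c i *: s`_i.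

Section BoundedOperators.
Variables (R : realType) (H : completeNormedModType R[i]).
Variable dot : {dot H for Num.conj}.

Definition bounded_operator : set (H -> H) :=
  [set T | [/\ forall x y, T (x + y) = T x + T y,
               forall (c : R[i]) x, T (c *: x) = c *: T x
             & exists M : R, forall x, rnorm (T x) <= M * rnorm x]].

(* The (unique, by Riesz) adjoint of a bounded operator; junk otherwise. *)
Definition adjoint (T : H -> H) : H -> H :=
  xget (fun=> 0) [set S | forall x y, dot (T x) y = dot x (S y)].

Definition BH : starAlg R :=
  @StarAlg R (H -> H) bounded_operator (fun S T => S \o T) adjoint.

End BoundedOperators.

Section FunctionAlgebras.
Variable R : realType.

Definition ell_infty (X : Type) : starAlg R :=
  @StarAlg R (X -> R[i])
    [set f | exists M : R, forall x, rnorm (f x) <= M]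
    (fun f g x => f x * g x) (fun f x => Num.conj (f x)).

Definition C0 (U : topologicalType) : starAlg R :=
  @StarAlg R (U -> R[i])
    [set f | continuous f /\
       forall e : R, 0 < e ->
         exists2 K : set U, compact K & forall u, ~ K u -> rnorm (f u) < e]
    (fun f g u => f u * g u) (fun f u => Num.conj (f u)).

End FunctionAlgebras.

(* A topological groupoid with space of arrows [G] and space of units [U].
   Since [rng \o gunit] is the identity and all structure maps are continuous,
   [gunit] is a homeomorphism of [U] onto the set of units of [G] with its
   subspace topology, so [U] is the unit space.
   The product [gmul x y] is only meaningful when [src x = rng y]. *)
Record topGroupoid (U G : topologicalType) := TopGroupoid {
  rng : G -> U;
  src : G -> U;
  gunit : U -> G;
  ginv : G -> G;
  gmul : G -> G -> G;
  rng_unit : forall u, rng (gunit u) = u;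
  src_unit : forall u, src (gunit u) = u;
  rng_inv : forall x, rng (ginv x) = src x;
  src_inv : forall x, src (ginv x) = rng x;
  rng_mul : forall x y, src x = rng y -> rng (gmul x y) = rng x;
  src_mul : forall x y, src x = rng y -> src (gmul x y) = src y;
  mul_assoc : forall x y z, src x = rng y -> src y = rng z ->
    gmul x (gmul y z) = gmul (gmul x y) z;
  mul_unitl : forall x, gmul (gunit (rng x)) x = x;
  mul_unitr : forall x, gmul x (gunit (src x)) = x;
  mul_inv : forall x, gmul x (ginv x) = gunit (rng x);
  inv_mul : forall x, gmul (ginv x) x = gunit (src x);
  rng_continuous : continuous rng;
  src_continuous : continuous src;
  unit_continuous : continuous gunit;
  inv_continuous : continuous ginv;
  mul_continuous :
    {within [set p : G * G | src p.1 = rng p.2],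
      continuous (fun p : G * G => gmul p.1 p.2)} }.

Definition homeomorphism_onto (X Y : topologicalType) (f : X -> Y)
    (B : set Y) : Prop :=
  [/\ continuous f, injective f, range f = B
    & forall V, open V -> exists2 W, open W & f @` V = B `&` W].

Definition local_homeomorphism (X Y : topologicalType) (f : X -> Y) : Prop :=
  forall x : X, exists O : set X,
    [/\ open O, O x, open (f @` O)
      & homeomorphism_onto (fun p : O => f (val p)) (f @` O)].

Definition etale (U G : topologicalType) (gG : topGroupoid U G) : Prop :=
  local_homeomorphism (rng gG) /\ local_homeomorphism (src gG).

Definition circle (R : realType) : set R[i] := [set z | `|z| = 1].
Arguments circle R : clear implicits.

Lemma circle_mul_subproof (R : realType) (z w : circle R) :
  val z * val w \in circle R.
Proof.
by apply/mem_set; rewrite /circle /= normrM (set_mem (valP z))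
  (set_mem (valP w)) mulr1.
Qed.

Definition circle_mul (R : realType) (z w : circle R) : circle R :=
  exist _ (val z * val w) (circle_mul_subproof z w).

Section Twist.
Variables (R : realType) (U G Sigma : topologicalType).
Variable gG : topGroupoid U G.

(* A twist [U * T -> Sigma -> G] over [G], with total groupoid [Sigma].
   The unit spaces of [Sigma] and [G] are both [U], and [quot] is the identity
   on units; an arrow of the trivial group bundle [U * T] is a pair [(u, z)],
   with range and source [u]. *)
Record twist := Twist {
  gS :> topGroupoid U Sigma;
  tiota : U * circle R -> Sigma;
  quot : Sigma -> G;
  twist_locally_compact : locally_compact [set: Sigma];
  twist_hausdorff : hausdorff_space Sigma;
  rng_iota : forall u z, rng gS (tiota (u, z)) = u;
  src_iota : forall u z, src gS (tiota (u, z)) = u;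
  iota_mul : forall u z w,
    tiota (u, circle_mul z w) = gmul gS (tiota (u, z)) (tiota (u, w));
  iota_homeo : homeomorphism_onto tiota (quot @^-1` range (gunit gG));
  rng_quot : forall s, rng gG (quot s) = rng gS s;
  src_quot : forall s, src gG (quot s) = src gS s;
  quot_mul : forall s t, src gS s = rng gS t ->
    quot (gmul gS s t) = gmul gG (quot s) (quot t);
  quot_continuous : continuous quot;
  quot_open : forall V, open V -> open (quot @` V);
  quot_surj : forall g, exists s, quot s = g;
  iota_central : forall s z,
    gmul gS (tiota (rng gS s, z)) s = gmul gS s (tiota (src gS s, z));
  twist_locally_trivial : forall g, exists O : set G,
    [/\ open O, O g
      & exists chart : O * circle R -> Sigma,
        [/\ homeomorphism_onto chart (quot @^-1` O),
            forall x z, quot (chart (x, z)) = val x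
          & forall x z w, chart (x, circle_mul z w) =
              gmul gS (tiota (rng gG (val x), z)) (chart (x, w))]] }.

Variable T : twist.

Definition act (z : circle R) (s : Sigma) : Sigma :=
  gmul T (tiota T (rng T s, z)) s.

Definition equivariant (f : Sigma -> R[i]) : Prop :=
  forall z s, f (act z s) = val z * f s.

(* A choice of one representative in [Sigma] for each element of [G]. *)
Definition rep (g : G) : Sigma := sval (cid (quot_surj T g)).

Definition Cc : set (Sigma -> R[i]) :=
  [set f | [/\ continuous f, compact (closure [set s | f s != 0])
             & equivariant f]].

(* If [f] and [g] are equivariant, the terms do not depend on [rep].  If [f] is
   moreover in [Cc] and [G] is étale, only finitely many terms are nonzero
   (the sum is by convention 0 when infinitely many are). *)
Definition convol (f g : Sigma -> R[i]) (s : Sigma) : R[i] :=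
  \sum_(x \in [set x : G | rng gG x = rng T s])
     f (rep x) * g (gmul T (ginv T (rep x)) s).

Definition invol (f : Sigma -> R[i]) (s : Sigma) : R[i] :=
  Num.conj (f (ginv T s)).

Definition l2norm (u : U) (h : Sigma -> R[i]) : \bar R :=
  sqrte (\esum_(x in [set x : G | src gG x = u]) (rnorm (h (rep x)) ^+ 2)%:E).

(* Functions on the fibre [Sigma_u] are extended by 0 to all of [Sigma]. *)
Definition l2 (u : U) : set (Sigma -> R[i]) :=
  [set h | [/\ forall s, src T s <> u -> h s = 0, equivariant h
             & (l2norm u h < +oo)%E]].

(* An operator on [l2 u]; [u] does not enter the formula. *)
Definition regular_rep (u : U) (f h : Sigma -> R[i]) : Sigma -> R[i] :=
  convol f h.

Definition l2_opnorm (u : U) (L : (Sigma -> R[i]) -> (Sigma -> R[i])) : \bar R :=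
  ereal_sup [set l2norm u (L h) | h in l2 u `&` [set h | (l2norm u h <= 1)%E]].

(* The [maxe 0] is for the empty groupoid: [ereal_sup set0 = -oo]. *)
Definition reduced_norm (f : Sigma -> R[i]) : \bar R :=
  maxe 0%E (ereal_sup [set l2_opnorm u (regular_rep u f) | u in [set: U]]).

(* The C*-algebra [A], together with the map [j], is the completion of the
   *-algebra [Cc] in the norm [reduced_norm]. *)
Definition is_reduced_cstar (A : cstarAlgType R) (j : (Sigma -> R[i]) -> A)
    : Prop :=
  [/\ {in Cc &, forall f g, j (f + g) = j f + j g} /\
      forall c : R[i], {in Cc, forall f, j (c *: f) = c *: j f},
      {in Cc &, forall f g, j (convol f g) = cmul (j f) (j g)},
      {in Cc, forall f, j (invol f) = cstar (j f)},
      {in Cc, forall f, (rnorm (j f))%:E = reduced_norm f}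
    & dense (j @` Cc)].

End Twist.

(* Main.v *)
(** If [C_0(U)] is isomorphic to [l^infty(X)], the preimages of the point masses
    are supported on isolated points of [U], so [U] has an infinite sequence
    of isolated points [u_n].  Their indicator functions lie in [C_c(G, Sigma)]
    and give nonzero orthogonal projections [p_n] of [C_r^*(G, Sigma)].  For
    [f] in [C_c(G, Sigma)], whose support is covered by finitely many open
    bisections, there is a [k] such that for each [n] at most [k] of the
    corners [p_m f p_n] are nonzero.  In [B(H)], pick unit vectors [e_n] in the
    range of (the image of) [p_n] and a bounded operator mapping [e_n] to
    [(n + 1)^(-1/2)] times the sum of [n + 1] distinct vectors [e_m].  It stays
    at distance at least 1/2 from every operator with at most [k] nonzero
    corners per column, contradicting the density of [C_c(G, Sigma)]. *)

Require Import Defs.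
From HB Require Import structures.
From mathcomp Require Import all_boot all_order all_algebra.
From mathcomp Require Import all_classical all_reals all_analysis.
From mathcomp Require Import complex sesquilinear lra.

Set Implicit Arguments.
Unset Strict Implicit.
Unset Printing Implicit Defensive.

Import Order.TTheory GRing.Theory Num.Theory.
Import numFieldNormedType.Exports.

Local Open Scope classical_set_scope.
Local Open Scope ring_scope.
Local Open Scope complex_scope.

(** * Hilbert spaces *)

Section RealNorm.
Variables (R : realType) (V : normedModType R[i]).
Implicit Types x y : V.

Lemma rnormE x : (rnorm x)%:C = `|x|.
Proof. by rewrite /rnorm RRe_real// ger0_real. Qed.

Lemma rnorm_ge0 x : 0 <= rnorm x.
Proof. by rewrite -ler0c rnormE. Qed.

Lemma rnorm_le x (c : R) : (rnorm x <= c) = (`|x| <= c%:C).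
Proof. by rewrite -rnormE lecR. Qed.

Lemma rnorm_eq0 x : (rnorm x == 0) = (x == 0).
Proof. by rewrite -(inj_eq (@complexI R)) rnormE normr_eq0. Qed.

Lemma rnormD x y : rnorm (x + y) <= rnorm x + rnorm y.
Proof. by rewrite rnorm_le rmorphD/= !rnormE ler_normD. Qed.

Lemma rnormZ (c : R[i]) x : rnorm (c *: x) = rnorm c * rnorm x.
Proof. by apply: complexI; rewrite rmorphM/= !rnormE normrZ. Qed.

End RealNorm.

Lemma rnorm_real (R : realType) (x : R) : rnorm x%:C = `|x|.
Proof. by rewrite /rnorm normc_def/= expr0n addr0 sqrtr_sqr. Qed.

Lemma rnormM (R : realType) (x y : R[i]) : rnorm (x * y) = rnorm x * rnorm y.
Proof. exact: rnormZ. Qed.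

Section Orthonormal.
Variables (R : realType) (H : completeNormedModType R[i]).
Variable dot : {dot H for Num.conj}.
Hypothesis H_hilbert : hilbert_dot dot.
Implicit Types x y : H.

Definition orthonormal_sequence (e : nat -> H) : Prop :=
  forall m n, dot (e m) (e n) = (m == n)%:R.

Lemma dotC x y : dot x y = Num.conj (dot y x).
Proof. by rewrite hermC mul1r. Qed.

Lemma rnorm_sqr x : (rnorm x ^+ 2)%:C = dot x x.
Proof. by rewrite rmorphXn/= rnormE H_hilbert. Qed.

Lemma orthonormal_unit (e : nat -> H) n :
  orthonormal_sequence e -> rnorm (e n) = 1.
Proof.
move=> oe; apply/eqP; rewrite -sqrp_eq1 ?rnorm_ge0//; apply/eqP/complexI.
by rewrite rnorm_sqr oe eqxx.
Qed.

Lemma dot_inj x y : (forall z, dot x z = dot y z) -> x = y.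
Proof.
move=> xy; apply/eqP; rewrite -subr_eq0 -(dnorm_eq0 dot).
have -> : dot (x - y) (x - y) = dot x (x - y) - dot y (x - y).
  by rewrite linearBl.
by rewrite xy subrr.
Qed.

Lemma dot_sum_orthonormal (e : nat -> H) (a : nat -> R[i]) (r : seq nat) k :
  orthonormal_sequence e -> uniq r ->
  dot (\sum_(i <- r) a i *: e i) (e k) = if k \in r then a k else 0.
Proof.
move=> oe ur; rewrite linear_sumlz.
under eq_bigr do rewrite linearZl_LR/= oe.
case: ifP => [kr|/negP kr].
  rewrite (bigD1_seq k)//= eqxx mulr1 big1 ?addr0// => i /negPf ->.
  by rewrite mulr0.
rewrite big_seq big1// => i ir.
by case: eqP ir => [->/kr//|_ _]; rewrite mulr0.
Qed.

Lemma pythagoras (e : nat -> H) (a : nat -> R[i]) (r : seq nat) :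
  orthonormal_sequence e -> uniq r ->
  rnorm (\sum_(i <- r) a i *: e i) ^+ 2 = \sum_(i <- r) rnorm (a i) ^+ 2.
Proof.
move=> oe ur; apply: complexI; rewrite rnorm_sqr.
rewrite [X in dot _ X]big_seq linear_sumr rmorph_sum/= [RHS]big_seq.
apply: eq_bigr => i ir; rewrite linearZr_LR/= dot_sum_orthonormal// ir.
by rewrite mulrC -normCK rmorphXn/= rnormE.
Qed.

(** Positivity of [dot (x - y) (x - y)], where [y] is the orthogonal projection of [x] onto the span
    of the [e i] with [i] in [r]. *)
Lemma bessel (e : nat -> H) x (r : seq nat) :
  orthonormal_sequence e -> uniq r ->
  \sum_(i <- r) rnorm (dot x (e i)) ^+ 2 <= rnorm x ^+ 2.
Proof.
move=> oe ur; set s := \sum_(i <- r) _.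
pose y := \sum_(i <- r) dot x (e i) *: e i.
have yy : dot y y = s%:C by rewrite -rnorm_sqr pythagoras.
have xy : dot x y = s%:C.
  rewrite linear_sumr rmorph_sum/=; apply: eq_bigr => i _.
  by rewrite linearZr_LR/= mulrC -normCK rmorphXn/= rnormE.
have : 0 <= dot (x - y) (x - y) by exact: dnorm_ge0.
rewrite dnormB/= yy xy -rnorm_sqr.
rewrite conj_Creal; last by apply/complex_realP; exists s.
rewrite opprD addrA addrK.
by rewrite subr_ge0 lecR.
Qed.


(** The argument of [bessel] for the single vector [y], which does not come as part of an
    orthonormal sequence. *)
Lemma dot_unit_le x y : rnorm y = 1 -> rnorm (dot x y) <= rnorm x.
Proof.
move=> y1; rewrite -(ler_pXn2r (ltn0Sn 1)) ?nnegrE ?rnorm_ge0//.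
set c := dot x y.
have cE : Num.conj c * c = (rnorm c ^+ 2)%:C.
  by rewrite mulrC -normCK rmorphXn/= rnormE.
have yy : dot y y = 1 by rewrite -rnorm_sqr y1 expr1n.
have : 0 <= dot (x - c *: y) (x - c *: y) by exact: dnorm_ge0.
rewrite dnormB/= dnormZ yy mulr1.
have -> : dot x (c *: y) = Num.conj c * c by rewrite linearZr_LR.
rewrite cE conj_Creal; last by apply/complex_realP; exists (rnorm c ^+ 2).
have -> : `|c| ^+ 2 = (rnorm c ^+ 2)%:C by rewrite rmorphXn/= rnormE.
by rewrite opprD addrA addrK -rnorm_sqr subr_ge0 lecR.
Qed.

(** The operator is the pointwise limit of the partial sums [S x]. By Pythagoras the squared norm of
    a tail of [S x] is a tail of the Bessel sum of [x]. *)
Lemma orthonormal_operator (e f : nat -> H) :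
  orthonormal_sequence e -> orthonormal_sequence f ->
  exists2 T : H -> H, bounded_operator T & forall n, T (e n) = f n.
Proof.
move=> oe ofl.
pose S x n := \sum_(0 <= i < n) dot x (e i) *: f i.
have SB x m n : (m <= n)%N -> S x n - S x m =
    \sum_(m <= i < n) dot x (e i) *: f i.
  by move=> mn; rewrite /S (@big_cat_nat _ _ _ m 0 n)//= addrAC subrr add0r.
have S_cvg x : cvgn (S x).
  (* Bessel bounds [b]. Past an index where [b] is within [eps ^+ 2] of its supremum, the tails of
     [S x] have norm below [eps]. *)
  pose b n := \sum_(0 <= i < n) rnorm (dot x (e i)) ^+ 2.
  have b_sup : has_sup (range b).
    split; first by exists (b 0%N), 0%N.
    by exists (rnorm x ^+ 2) => _ [n _ <-]; apply: bessel; rewrite ?iota_uniq.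
  apply: cauchy_cvg; apply: cauchy_exP => eps eps0.
  have eps0' : 0 < complex.Re eps by move: eps0; rewrite ltcE => /andP[].
  have epsE : eps = (complex.Re eps)%:C by rewrite RRe_real// gtr0_real.
  have [_ [N _ <-] Nb] := sup_adherent (exprn_gt0 2 eps0') b_sup.
  exists (S x N); exists N => // n /= Nn.
  rewrite -ball_normE /= distrC SB//.
  rewrite -rnormE epsE ltcR -(ltr_pXn2r (ltn0Sn 1)) ?nnegrE ?rnorm_ge0 ?ltW//.
  rewrite pythagoras ?iota_uniq//.
  have -> : \sum_(N <= i < n) rnorm (dot x (e i)) ^+ 2 = b n - b N.
    by rewrite /b (@big_cat_nat _ _ _ N 0 n)//= addrAC subrr add0r.
  rewrite ltrBlDr; apply: le_lt_trans (_ : sup (range b) < _).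
    by apply: sup_upper_bound => //; exists n.
  by rewrite -ltrBlDl.
have Sx x : S x n @[n --> \oo] --> limn (S x) by exact: S_cvg.
exists (fun x => limn (S x)); first split.
- move=> x y; apply/cvg_lim => //; rewrite (_ : S (x + y) = S x + S y).
    exact: cvgD.
  apply/funext => n; rewrite fctE /S -big_split/=.
  by apply: eq_bigr => i _; rewrite linearDl scalerDl.
- move=> c x; apply/cvg_lim => //; rewrite (_ : S (c *: x) = c \*: S x).
    exact: cvgZl_tmp.
  apply/funext => n; rewrite /S /= scaler_sumr.
  by apply: eq_bigr => i _; rewrite linearZl_LR scalerA.
- exists 1 => x; rewrite mul1r; apply/ler_addgt0Pr => eps eps0.
  have eps0' : 0 < eps%:C by rewrite (ltcR 0).
  have /cvgrPdist_lt /(_ _ eps0') [n _ /(_ n (leqnn n))] := Sx x.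
  rewrite -rnormE ltcR => le_n.
  rewrite -[limn _](subrK (S x n)) (le_trans (rnormD _ _))// addrC.
  rewrite lerD ?(ltW le_n)//.
  rewrite -(ler_pXn2r (ltn0Sn 1)) ?nnegrE ?rnorm_ge0//.
  by rewrite pythagoras ?iota_uniq// bessel ?iota_uniq.
- move=> n; apply/cvg_lim => //; apply: cvg_near_cst.
  exists n.+1 => // m /= nm; rewrite /S (bigD1_seq n) ?iota_uniq//=.
    by rewrite oe eqxx scale1r big1 ?addr0// => i /negPf;
       rewrite eq_sym oe => ->; rewrite scale0r.
  by rewrite mem_index_iota.
Qed.

End Orthonormal.

(** * Isomorphisms onto [B(H)] *)

Section Isomorphism.
Variables (R : realType) (H : completeNormedModType R[i]).
Variable dot : {dot H for Num.conj}.
Hypothesis H_hilbert : hilbert_dot dot.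

Lemma adjoint_unique (S T : H -> H) :
  (forall x y, dot (T x) y = dot x (S y)) -> adjoint dot T = S.
Proof.
move=> TS; rewrite /adjoint; case: xgetP => [_ -> TS'|/(_ S)]; last by move/(_ TS).
apply/funext => y; apply: (dot_inj (dot := dot)) => x.
by rewrite (dotC dot) -TS' TS -(dotC dot).
Qed.

(** This avoids the Riesz theorem: in the default case of [xget] the value is the zero map, so [T]
    is zero and both sides vanish. *)
Lemma adjoint_self (T : H -> H) x y : adjoint dot T = T ->
  dot (T x) y = dot x (T y).
Proof.
rewrite /adjoint; case: xgetP => [S -> TS ST|_ <-]; first by rewrite TS ST.
by rewrite /= linear0l linear0r.
Qed.

Definition rank_one (eta xi : H) : H -> H := fun x => dot x xi *: eta.

Lemma rank_one_bounded eta xi :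
  rnorm xi = 1 -> bounded_operator (rank_one eta xi).
Proof.
move=> xi1; split => [x y|c x|]; first by rewrite /rank_one linearDl scalerDl.
  by rewrite /rank_one linearZl_LR scalerA.
exists (rnorm eta) => x; rewrite rnormZ mulrC ler_wpM2l ?rnorm_ge0//.
exact: dot_unit_le.
Qed.

Lemma adjoint_rank_one eta xi :
  adjoint dot (rank_one eta xi) = rank_one xi eta.
Proof.
apply: adjoint_unique => x y; rewrite /rank_one linearZl_LR linearZr_LR/=.
by rewrite -(dotC dot) mulrC.
Qed.

Variables (A : cstarAlgType R) (phi : A -> H -> H).
Hypothesis phi_iso : @star_isomorphism R (cstar_starAlg A) (BH dot) phi.

Lemma iso_bounded a : bounded_operator (phi a).
Proof. by case: phi_iso => -[phiT _ _] _ _ _ _; exact: phiT. Qed.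

Lemma iso_surj T : bounded_operator T -> exists a, phi a = T.
Proof. by case: phi_iso => -[_ _ phi_surj] _ _ _ _ /phi_surj[a]; exists a. Qed.

Lemma iso_inj a b : phi a = phi b -> a = b.
Proof.
by case: phi_iso => -[_ phi_inj _] _ _ _ _; apply: phi_inj; exact: in_setT.
Qed.

Lemma isoD a b x : phi (a + b) x = phi a x + phi b x.
Proof. by case: phi_iso => _ phiD _ _ _; rewrite phiD//; exact: in_setT. Qed.

Lemma isoZ c a x : phi (c *: a) x = c *: phi a x.
Proof. by case: phi_iso => _ _ phiZ _ _; rewrite phiZ//; exact: in_setT. Qed.

Lemma isoB a b x : phi (a - b) x = phi a x - phi b x.
Proof. by rewrite isoD -scaleN1r isoZ scaleN1r. Qed.

Lemma iso0 x : phi 0 x = 0.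
Proof. by rewrite -(scale0r 0) isoZ scale0r. Qed.

Lemma isoM a b : phi (cmul a b) = phi a \o phi b.
Proof. by case: phi_iso => _ _ _ phiM _; exact: phiM (in_setT _) (in_setT _). Qed.

Lemma iso_star a : phi (cstar a) = adjoint dot (phi a).
Proof. by case: phi_iso => _ _ _ _; apply; exact: in_setT. Qed.

(** The norm is computed inside [A]. If [p] corresponds to the projection onto [xi], then
    [p^* p = p] and [p] is nonzero, so the C*-identity gives norm 1; then [a^* a = p] gives the same
    for [a]. *)
Lemma iso_rank_one_norm a eta xi : rnorm eta = 1 -> rnorm xi = 1 ->
  phi a = rank_one eta xi -> `|a| = 1.
Proof.
move=> eta1 xi1 aE.
have unitE x : rnorm x = 1 -> dot x x = 1.
  by move=> x1; rewrite -rnorm_sqr// x1 expr1n.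
have [p pE] := iso_surj (rank_one_bounded xi xi1).
have starE b y : rnorm y = 1 -> phi b = rank_one y xi -> cmul (cstar b) b = p.
  move=> y1 bE; apply: iso_inj; rewrite isoM iso_star bE adjoint_rank_one pE.
  by apply/funext => x; rewrite /= /rank_one linearZl_LR/= unitE// mulr1.
have p0 : p != 0.
  apply/eqP => p0; have := congr1 (fun T => T xi) pE.
  rewrite p0 iso0 /rank_one unitE// scale1r => /esym xi0.
  by move: xi1 => /eqP; rewrite xi0 (_ : rnorm 0 = 0) ?(eq_sym 0) ?oner_eq0//;
     apply/eqP; rewrite rnorm_eq0.
have p1 : `|p| = 1.
  have := cnorm_star p; rewrite (starE p xi)// expr2 => /esym/eqP.
  by rewrite -subr_eq0 -[X in _ - X]mulr1 -mulrBr mulf_eq0 normr_eq0 (negPf p0)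
    subr_eq0 => /eqP.
have := cnorm_star a; rewrite (starE a eta)// p1 => /esym/eqP.
rewrite sqrp_eq1//; exact/eqP.
Qed.

(* Sandwiching [d] between rank one operators with unit vectors gives a
   multiple of a rank one projection, and in [A] all these have norm one by
   the C*-identity; no spectral theory is needed. *)
Lemma iso_contractive d xi eta : rnorm eta = 1 -> rnorm xi = 1 ->
  rnorm (dot (phi d xi) eta) <= rnorm d.
Proof.
move=> eta1 xi1.
have [p pE] := iso_surj (rank_one_bounded xi xi1).
have [a aE] := iso_surj (rank_one_bounded xi eta1).
have adp : cmul a (cmul d p) = dot (phi d xi) eta *: p.
  apply: iso_inj; rewrite !isoM aE pE; apply/funext => x /=.
  have [_ dZ _] := iso_bounded d.
  by rewrite isoZ pE /rank_one dZ linearZl_LR scalerA mulrC.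
rewrite -lecR !rnormE.
have := congr1 (fun x => `|x|) adp; rewrite /= normrZ.
rewrite (iso_rank_one_norm xi1 xi1 pE) mulr1 => <-.
apply: (le_trans (cnormM _ _)); rewrite (iso_rank_one_norm xi1 eta1 aE) mul1r.
apply: (le_trans (cnormM _ _)).
by rewrite (iso_rank_one_norm xi1 xi1 pE) mulr1.
Qed.

End Isomorphism.

(** * Orthonormal vectors spread evenly over disjoint finite blocks *)

Section FlatVectors.
Variables (R : realType) (H : completeNormedModType R[i]).
Variable dot : {dot H for Num.conj}.
Hypothesis H_hilbert : hilbert_dot dot.
Variable e : nat -> H.
Hypothesis e_orthonormal : orthonormal_sequence dot e.

(** Encoding the pairs [(n, i)] with [i <= n] by the injective [pickle] makes the blocks of
    different [n] disjoint. *)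
Definition flat_block (n : nat) : seq nat :=
  [seq pickle (n, i) | i <- iota 0 n.+1].

Definition flat_coef (n : nat) : R := (Num.sqrt n.+1%:R)^-1.

Definition flat_vector (n : nat) : H :=
  \sum_(i <- flat_block n) (flat_coef n)%:C *: e i.

Lemma flat_block_uniq n : uniq (flat_block n).
Proof.
rewrite map_inj_uniq ?iota_uniq// => i j.
by move/(pcan_inj pickleK) => -[].
Qed.

Lemma flat_block_disjoint m n k :
  k \in flat_block m -> k \in flat_block n -> m = n.
Proof. by move=> /mapP[i _ ->] /mapP[j _] /(pcan_inj pickleK)[]. Qed.

Lemma flat_coef_ge0 n : 0 <= flat_coef n.
Proof. by rewrite invr_ge0 sqrtr_ge0. Qed.

Lemma flat_coef_sqr n : flat_coef n ^+ 2 *+ n.+1 = 1.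
Proof. by rewrite exprVn sqr_sqrtr// -mulr_natr mulVf. Qed.

Lemma dot_flat_vector x n :
  dot x (flat_vector n) = (flat_coef n)%:C * \sum_(i <- flat_block n) dot x (e i).
Proof.
rewrite linear_sumr mulr_sumr; apply: eq_bigr => i _; rewrite linearZr_LR/=.
by rewrite conj_Creal//; apply/complex_realP; exists (flat_coef n).
Qed.

Lemma flat_vector_orthonormal : orthonormal_sequence dot flat_vector.
Proof.
move=> m n; rewrite dot_flat_vector.
under eq_bigr do rewrite dot_sum_orthonormal ?flat_block_uniq//.
have [->|mn] := eqVneq m n.
  rewrite big_seq; under eq_bigr => i -> do [].
  rewrite -big_seq big_const_seq count_predT iter_addr_0 size_map size_iota.
  by rewrite mulrnAr -rmorphM/= -expr2 -rmorphMn/= flat_coef_sqr.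
rewrite big_seq big1 ?mulr0// => i im.
case: ifP => // im'; case/eqP: mn; exact: flat_block_disjoint im' im.
Qed.

End FlatVectors.

(** * Operators with boundedly many nonzero corners in each column *)

Section Band.
Variables (R : realType) (H : completeNormedModType R[i]).
Variable dot : {dot H for Num.conj}.
Hypothesis H_hilbert : hilbert_dot dot.
Variables (A : cstarAlgType R) (phi : A -> H -> H).
Hypothesis phi_iso : @star_isomorphism R (cstar_starAlg A) (BH dot) phi.
Variable p : nat -> A.
Hypotheses (p_idem : forall n, cmul (p n) (p n) = p n)
  (p_star : forall n, cstar (p n) = p n)
  (p_orth : forall m n, m != n -> cmul (p m) (p n) = 0)
  (p_neq0 : forall n, p n != 0).

(** Duplicate-free lists stand for finite sets of rows. The bound [k] is the same for all columns
    [n]. *)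
Definition band (k : nat) (a : A) : Prop :=
  forall n (r : seq nat), uniq r ->
    (forall m, m \in r -> cmul (cmul (p m) a) (p n) != 0) -> (size r <= k)%N.

Lemma proj_self n x y : dot (phi (p n) x) y = dot x (phi (p n) y).
Proof. by apply: adjoint_self; rewrite -(iso_star phi_iso) p_star. Qed.

(** Injectivity of [phi] makes each [phi (p n)] nonzero, so its range contains a unit vector;
    self-adjointness and [p_orth] make the ranges orthogonal. *)
Lemma range_unit_vectors :
  exists e, orthonormal_sequence dot e /\ forall n, phi (p n) (e n) = e n.
Proof.
have unit_vec n : exists x, rnorm x = 1 /\ phi (p n) x = x.
  have [y y0] : exists y, phi (p n) y != 0.
    apply: contrapT => /forallNP y0; case/eqP: (p_neq0 n).
    apply: (iso_inj phi_iso); apply/funext => y; rewrite (iso0 phi_iso).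
    by apply: contrapT => /eqP; exact: y0.
  set z := phi (p n) y in y0.
  exists ((rnorm z)^-1%:C *: z); split.
    rewrite rnormZ rnorm_real normfV ger0_norm ?rnorm_ge0//.
    by rewrite mulVf// rnorm_eq0.
  have [_ pZ _] := iso_bounded phi_iso (p n).
  by rewrite pZ; congr (_ *: _); rewrite /z -[in RHS](p_idem n) (isoM phi_iso).
have [e eP] := choice unit_vec; exists e; split=> [m n|n]; last by have [] := eP n.
have [em pm] := eP m; have [en pn] := eP n.
have [<-|mn] := eqVneq m n; first by rewrite -rnorm_sqr// em expr1n.
rewrite -pm -pn proj_self -[phi (p m) _]/((phi (p m) \o phi (p n)) _).
by rewrite -(isoM phi_iso) p_orth// (iso0 phi_iso) linear0r.
Qed.

(** The number [dot (phi d (e n)) (flat_vector e n)] is estimated twice, for [d] in [D] within 1/2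
    of the preimage [a] of [T]. It exceeds 1/2 because [d] is close to [a]. It is at most
    [k * rnorm d / sqrt (n + 1)] because at most [k] of the coefficients in the block are nonzero,
    each bounded by [rnorm d]. *)
Lemma no_dense_band (D : set A) : dense D ->
  (forall a, D a -> exists k, band k a) -> False.
Proof.
move=> D_dense D_band.
have [e [oe pe]] := range_unit_vectors.
have e1 n := orthonormal_unit H_hilbert n oe.
have ofl := flat_vector_orthonormal oe.
have f1 n := orthonormal_unit H_hilbert n ofl.
have [T T_bounded Te] := orthonormal_operator H_hilbert oe ofl.
have [a aE] := iso_surj phi_iso T_bounded.
have half0 : 0 < (2^-1 : R)%:C by rewrite (ltcR 0) invr_gt0.
have [d [ad Dd]] : ball a (2^-1)%:C `&` D !=set0.
  apply: D_dense; last exact: ball_open.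
  by exists a; apply: ballxx.
have {}ad : rnorm (a - d) < 2^-1.
  by move: ad; rewrite -ball_normE /= -rnormE ltcR.
have [k dk] := D_band _ Dd.
(* Chosen so that [n + 1] exceeds [(2 * k * rnorm d) ^ 2], which brings the second estimate down to
   1/2. *)
pose n := Num.truncn ((2 * (k%:R * rnorm d)) ^+ 2).
have coef_small : flat_coef R n * (k%:R * rnorm d) <= 2^-1.
  rewrite /flat_coef mulrC ler_pdivrMr ?sqrtr_gt0// ler_pdivlMl//.
  rewrite -(ler_pXn2r (ltn0Sn 1)) ?nnegrE ?sqrtr_ge0 ?mulr_ge0 ?rnorm_ge0//.
  rewrite sqr_sqrtr//; apply: ltW; exact: truncnS_gt.
have dE : dot (phi d (e n)) (flat_vector e n) =
    1 - dot (phi (a - d) (e n)) (flat_vector e n).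
  by rewrite (isoB phi_iso) aE Te linearBl/= ofl eqxx opprB addrC subrK.
have big : 2^-1 < rnorm (dot (phi d (e n)) (flat_vector e n)).
  rewrite dE; set z := dot _ _.
  have z_small : rnorm z < 2^-1.
    exact: le_lt_trans (iso_contractive H_hilbert phi_iso _ _ _) ad.
  have := rnormD (1 - z) z; rewrite subrK (rnorm_real 1) normr1.
  lra.
have small : rnorm (dot (phi d (e n)) (flat_vector e n)) <= 2^-1.
  apply: le_trans coef_small; rewrite dot_flat_vector.
  rewrite rnormM rnorm_real.
  rewrite ger0_norm ?flat_coef_ge0// ler_wpM2l ?flat_coef_ge0//.
  set nz := [pred i | dot (phi d (e n)) (e i) != 0].
  rewrite (bigID nz)/= [X in _ + X]big1 ?addr0; last first.
    by move=> i /negPn/eqP.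
  rewrite -big_filter; set r := [seq i <- _ | _].
  have r_le : (size r <= k)%N.
    apply: (dk n); first by rewrite filter_uniq// flat_block_uniq.
    (* Since [p m] fixes [e m] and [p n] fixes [e n], the coefficient of [d] at [(m, n)] is that of
       the corner, so a zero corner makes it vanish. *)
    move=> m; rewrite mem_filter => /andP[nz_m _]; apply: contraNneq nz_m => pdp.
    rewrite -(pe m) -proj_self -(pe n).
    have := iso0 phi_iso (e n); rewrite -pdp !(isoM phi_iso) /= => ->.
    by rewrite linear0l eqxx.
  apply: le_trans (_ : (size r)%:R * rnorm d <= _); last first.
    by rewrite ler_wpM2r ?rnorm_ge0// ler_nat.
  elim: (r) => [|i s IHs]; first by rewrite big_nil (rnorm_real 0) normr0 mul0r.
  rewrite big_cons (le_trans (rnormD _ _))//= -natr1 mulrDl mul1r addrC lerD//.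
  exact: iso_contractive.
by move: (lt_le_trans big small); rewrite ltxx.
Qed.

End Band.

(** * Isolated points of the unit space *)

Lemma real_complex_continuous (R : realType) : continuous (fun x : R => x%:C).
Proof.
move=> x; apply/cvgrPdist_lt => eps eps0.
have epsE : eps = (complex.Re eps)%:C by rewrite RRe_real// gtr0_real.
move: eps0; rewrite epsE (ltcR 0) => eps0.
have /cvgrPdist_lt /(_ _ eps0) := @cvg_id _ (nbhs x).
apply: filterS => y /=; rewrite -(ltcR `|x - y|); apply: le_lt_trans.
by rewrite -rmorphB/= -(rnormE (_ : R[i])) rnorm_real.
Qed.

Lemma neq0_open (R : realType) (T : topologicalType) (f : T -> R[i]) :
  continuous f -> open [set x | f x != 0].
Proof.
move=> f_cont; rewrite [X in open X](_ : _ = f @^-1` ~` [set 0]).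
  apply: open_comp; first by move=> x _; exact: f_cont.
  apply: closed_openC; apply: accessible_closed_set1.
  exact: hausdorff_accessible.
by apply/seteqP; split=> x /= /eqP.
Qed.

Section IsolatedPoints.
Variables (R : realType) (U : topologicalType).
Hypothesis U_separated : forall u v : U, u <> v ->
  exists g : U -> R, [/\ continuous g, forall w, 0 <= g w <= 1, g u = 0 & g v = 1].

(** The bound on [g] is asked only where [f] has norm at most 1, so that [g] may itself contain the
    factor [f]. The threshold [Num.min e 1] makes it available off a compact set. *)
Lemma C0M (f g : U -> R[i]) : elts (C0 R U) f -> continuous g ->
  (forall u, rnorm (f u) <= 1 -> rnorm (g u) <= 1) ->
  elts (C0 R U) (fun u => f u * g u).
Proof.
move=> [f_cont f_small] g_cont g_le; split.
  by move=> u; apply: continuousM; [exact: f_cont|exact: g_cont].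
move=> e e0; have [|K K_compact fK] := f_small (Num.min e 1).
  by rewrite lt_min e0 ltr01.
exists K => // u /fK; rewrite lt_min => /andP[fe /ltW f1].
by rewrite rnormM (le_lt_trans _ fe)// ler_piMr ?rnorm_ge0// g_le.
Qed.

Lemma C0Z (c : R[i]) (f : U -> R[i]) :
  elts (C0 R U) f -> elts (C0 R U) (c *: f).
Proof.
move=> [f_cont f_small]; split.
  by move=> u; apply: continuousM; [exact: cst_continuous|exact: f_cont].
have c0 : 0 < rnorm c + 1 by rewrite ltr_wpDl ?rnorm_ge0.
move=> e e0; have [|K K_compact fK] := f_small (e / (rnorm c + 1)).
  exact: divr_gt0.
exists K => // u /fK; rewrite ltr_pdivlMr// => fe.
rewrite [rnorm _]rnormM (le_lt_trans _ fe)// mulrC ler_wpM2l ?rnorm_ge0//.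
by rewrite lerDl.
Qed.

Variables (X : Type) (phi : (U -> R[i]) -> (X -> R[i])).
Hypothesis phi_iso : @star_isomorphism R (C0 R U) (ell_infty R X) phi.

Let delta (x y : X) : R[i] := (`[< y = x >])%:R.

(** A point mass is a minimal projection: its product with any function is a multiple of it. Hence
    [f * (f * g)] is a multiple of [f] for every continuous [g] with values in [0, 1], which fails
    if [g] separates two points of the support. *)
Lemma isolated_support (x : X) : exists (f : U -> R[i]) (u : U),
  [/\ elts (C0 R U) f, phi f = delta x & [set v | f v != 0] = [set u]].
Proof.
have [[_ phi_inj phi_surj] _ phiZ phiM _] := phi_iso.
have [|f fC0 fx] := phi_surj (delta x).
  by exists 1 => y; rewrite /delta; case: asboolP => _ /=;
     rewrite /rnorm ?normr1 ?normr0// ler01.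
have [u fu0] : exists u, f u != 0.
  apply: contrapT => /forallNP f0; have := phiZ 0 f (mem_set fC0).
  have -> : 0 *: f = f.
    rewrite scale0r; apply/funext => u; apply/esym/eqP; rewrite -[_ == _]negbK.
    by apply/negP; exact: f0.
  rewrite fx scale0r => /(congr1 (fun h => h x)); rewrite /delta asboolT// => /eqP.
  by rewrite oner_eq0.
exists f, u; split=> //; apply/seteqP; split=> [v /= fv0|_ ->//].
apply: contrapT => /U_separated[g [g_cont g01 gv gu]].
pose g' w := (g w)%:C.
have g'_cont : continuous g'.
  by move=> w; apply: continuous_comp; [exact: g_cont|exact: real_complex_continuous].
have g'1 w : rnorm (g' w) <= 1.
  by rewrite rnorm_real; have /andP[? ?] := g01 w; rewrite ger0_norm.
(* [g'] need not vanish at infinity, so [phi] is applied to [f * g'] instead. *)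
have fgC0 : elts (C0 R U) (fun w => f w * g' w) by apply: C0M.
have ffgC0 : elts (C0 R U) (fun w => f w * (f w * g' w)).
  apply: C0M => //; first by have [] := fgC0.
  by move=> w fw; rewrite rnormM mulr_ile1 ?rnorm_ge0.
pose c := phi (fun w => f w * g' w) x.
have ffgE : (fun w => f w * (f w * g' w)) = c *: f.
  apply: phi_inj; [exact: mem_set|exact/mem_set/C0Z|].
  rewrite phiZ ?fx; last exact: mem_set.
  have := phiM f _ (mem_set fC0) (mem_set fgC0); rewrite /= fx => ->.
  apply/funext => y; rewrite -[RHS]/(c * delta x y) /delta.
  by case: asboolP => [->|_]; rewrite ?mul1r ?mulr1 ?mul0r ?mulr0.
have := congr1 (fun h => h v) ffgE; rewrite /= /g' gv !mulr0 => /esym/eqP.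
rewrite mulf_eq0 (negPf fv0) orbF => /eqP c0.
have := congr1 (fun h => h u) ffgE; rewrite /= c0 /g' gu mulr1 scale0r => /eqP.
by rewrite mulf_eq0 (negPf fu0).
Qed.

(** The point [u n] is isolated as the support of the continuous [f n]. If [u m = u n], then [f m]
    and [f n] are proportional, hence so are the point masses at [x m] and [x n]. *)
Lemma isolated_sequence : infinite_set [set: X] ->
  exists2 u : nat -> U, injective u & forall n, open [set u n].
Proof.
move=> /infiniteP X_inf.
have [x x_inj] : exists x : nat -> X, injective x.
  have /card_leP[h] := X_inf.
  exists (fun n => val (h (exist _ n (mem_set I)))) => m n /val_inj.
  by move/(inj (in_setT _) (in_setT _)) => -[].
have [f fP] := choice (fun n => isolated_support (x n)).
have [u uP] := choice fP.
exists u => [m n umn|n]; last first.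
  by have [[f_cont _] _ <-] := uP n; exact: neq0_open.
have [[_ _ phi_surj] _ phiZ _ _] := phi_iso.
have [fmC0 fm fmu] := uP m; have [fnC0 fn fnu] := uP n.
have fmE : f m = (f m (u m) / f n (u m)) *: f n.
  apply/funext => v; rewrite -[RHS]/(_ * f n v).
  have [->|vu] := pselect (v = u m).
    have fnm : [set v | f n v != 0] (u m) by rewrite fnu.
    by rewrite divfK.
  have f0 k : u k = u m -> [set v | f k v != 0] = [set u k] -> f k v = 0.
    move=> ukm fk; apply/eqP; rewrite -[_ == _]negbK; apply/negP => fv.
    by apply: vu; rewrite -ukm; have : [set u k] v by rewrite -fk.
  by rewrite (f0 m)// (f0 n)// mulr0.
have : delta (x m) (x m) = (f m (u m) / f n (u m)) * delta (x n) (x m).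
  rewrite -{1}fm -fn; move: (f m (u m) / _) fmE => c ->.
  by rewrite phiZ//; exact: mem_set.
rewrite /delta asboolT//; case: asboolP => [/x_inj//|_].
by rewrite mulr0 => /eqP; rewrite oner_eq0.
Qed.

End IsolatedPoints.

(** * Topological preliminaries: compactness and clopen sets *)

(** The upper and lower half circles are continuous images of [-1, 1]. *)
Lemma circle_compact (R : realType) : compact (circle R).
Proof.
pose h (b : bool) (t : R) : R[i] :=
  t%:C + 'i * ((-1) ^+ b * Num.sqrt (1 - t ^+ 2))%:C.
have h_cont b : continuous (h b).
  move=> t; apply: continuousD; first exact: real_complex_continuous.
  apply: continuousM; first exact: cst_continuous.
  apply: (continuous_comp _ (@real_complex_continuous R _)).
  apply: continuousM; first exact: cst_continuous.
  apply: (continuous_comp _ (@sqrt_continuous R _)).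
  apply: continuousB; first exact: cst_continuous.
  exact: exprn_continuous.
have h_compact b : compact (h b @` `[-1, 1]).
  apply: continuous_compact; last exact: segment_compact.
  exact: continuous_subspaceT.
suff -> : circle R = h false @` `[-1, 1] `|` h true @` `[-1, 1].
  exact: compactU.
have hE b t : h b t = t +i* ((-1) ^+ b * Num.sqrt (1 - t ^+ 2)).
  by rewrite /h [RHS]complexE.
have sqrP (t : R) : t \in `[-1, 1] -> 0 <= 1 - t ^+ 2.
  by rewrite in_itv/= => /andP[? ?]; nra.
have h_circle b t : t \in `[-1, 1] -> circle R (h b t).
  move=> /sqrP t1; rewrite /circle /= hE normc_def/= exprMn sqr_sqrtr//.
  by rewrite -exprM mulnC exprM sqrrN !expr1n mul1r addrC subrK sqrtr1.
apply/seteqP; split; last by move=> _ [] [t t1 <-]; exact: h_circle.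
case=> a b; rewrite /circle /= normc_def/= => /(@complexI R) ab1.
have {}ab1 : a ^+ 2 + b ^+ 2 = 1.
  by rewrite -[LHS]sqr_sqrtr ?ab1 ?expr1n// addr_ge0 ?sqr_ge0.
have a1 : a \in `[-1, 1].
  by rewrite in_itv/=; apply/andP; split; nra.
have bE : Num.sqrt (1 - a ^+ 2) = `|b| by rewrite -ab1 addrC addKr sqrtr_sqr.
have [b0|b0] := leP 0 b; [left|right]; exists a => //; rewrite hE bE.
  by rewrite ger0_norm// mul1r.
by rewrite ltr0_norm// mulN1r opprK.
Qed.

Lemma open_setX (S T : topologicalType) (A : set S) (B : set T) :
  open A -> open B -> open (A `*` B).
Proof.
move=> oA oB; rewrite openE => -[x y] [/= Ax By]; exists (A, B) => //.
by split; apply: open_nbhs_nbhs.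
Qed.

(** Needed because [circle R] occurs as a type in the domain of [tiota]. The filter pushed forward
    along [val] has a cluster point in [A]. *)
Lemma compact_setT_type (T : topologicalType) (A : set T) :
  compact A -> compact [set: A].
Proof.
move=> A_compact F F_proper _.
have [|x [Ax Fx]] := A_compact (val @ F) _.
  have AT : val @^-1` A = [set: A].
    by apply/seteqP; split=> // a _; exact: set_mem (valP a).
  by rewrite nbhs_simpl/= AT; exact: filterT.
exists (exist _ x (mem_set Ax)); split=> // B N FB [_ [[V oV <-] Vx] VN].
have [_ [[a Ba <-] Va]] : (val @` B) `&` V !=set0.
  apply: Fx; first by rewrite nbhs_simpl/=; apply: filterS FB => a Ba; exists a.
  exact: open_nbhs_nbhs.
by exists a; split=> //; exact: VN.
Qed.

Lemma compact_finite_subcover (T : topologicalType) (K : set T)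
    (O : T -> set T) : compact K -> (forall x, open (O x)) ->
  (forall x, O x x) ->
  exists s : seq T, forall x, K x -> exists2 y, y \in s & O y x.
Proof.
move=> K_compact oO Oxx.
(* [compact_cover] is applied to a pointed type; a point of [K] provides one, and the empty list
   covers an empty [K]. *)
have [[x0 _]|K0] := pselect (K !=set0); last first.
  by exists [::] => x Kx; case: K0; exists x.
pose T' : ptopologicalType := HB.pack T (isPointed.Build T x0).
have : @compact T' K by exact: K_compact.
rewrite compact_cover => Kc; have [|s _ Ks] := Kc T setT O (fun x _ => oO x).
  by move=> x _; exists x.
exists (finmap.enum_fset s) => x /Ks[y ys Oyx]; by exists y.
Qed.

Lemma patch0_continuous (R : realType) (T : topologicalType) (A : set T)
    (f : T -> R[i]) :
  open A -> closed A -> {in A, continuous f} -> continuous (f \_ A).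
Proof.
move=> oA cA f_cont x; have [Ax|nAx] := pselect (A x).
  have fx : (f \_ A) x = f x by rewrite /patch mem_set.
  rewrite /continuous_at fx.
  apply: cvg_trans (f_cont x (mem_set Ax)); apply: near_eq_cvg.
  apply: filterS (open_nbhs_nbhs (conj oA Ax)) => y Ay.
  by rewrite /patch mem_set.
have fx : (f \_ A) x = 0 by rewrite /patch memNset.
rewrite /continuous_at fx; apply: cvg_near_cst.
apply: filterS (open_nbhs_nbhs (conj (closed_openC cA) nAx)) => y nAy.
by rewrite /patch memNset.
Qed.

(** * Indicators of isolated units *)

Section Groupoid.
Variables (U G : topologicalType) (gG : topGroupoid U G).
Implicit Types x y : G.

(** Cancel one [x] in the isotropy group. *)
Lemma gmul_inj_unit x : src gG x = rng gG x -> gmul gG x x = x ->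
  x = gunit gG (rng gG x).
Proof.
move=> sx xx; rewrite -(mul_inv gG x) -{2}xx -mul_assoc ?rng_inv//.
by rewrite mul_inv -sx mul_unitr.
Qed.

Lemma gmulKV x y : rng gG x = rng gG y ->
  gmul gG x (gmul gG (ginv gG x) y) = y.
Proof.
by move=> xy; rewrite mul_assoc ?rng_inv ?src_inv// mul_inv xy mul_unitl.
Qed.

Lemma gunit_inj : injective (gunit gG).
Proof. by move=> u v /(congr1 (rng gG)); rewrite !rng_unit. Qed.

End Groupoid.

Section Bump.
Variables (R : realType) (U G Sigma : topologicalType) (gG : topGroupoid U G).
Variable T : twist R Sigma gG.
Implicit Types (u : U) (s t : Sigma) (z w : circle R) (f : Sigma -> R[i]).

Lemma tiota_inj : injective (tiota T).
Proof. by have [] := iota_homeo T. Qed.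

Lemma quot_tiota u z : quot T (tiota T (u, z)) = gunit gG u.
Proof.
have [_ _ iotaE _] := iota_homeo T.
have : range (tiota T) (tiota T (u, z)) by exists (u, z).
rewrite iotaE => -[v _ vE]; rewrite -vE; congr gunit.
by have := rng_quot T (tiota T (u, z)); rewrite -vE rng_unit rng_iota.
Qed.

Lemma quot_unit_tiota u s : quot T s = gunit gG u -> exists z, s = tiota T (u, z).
Proof.
move=> su; have [_ _ iotaE _] := iota_homeo T.
have : (quot T @^-1` range (gunit gG)) s by exists u.
rewrite -iotaE => -[[v z] _ vz]; exists z; rewrite -vz; congr (tiota T (_, z)).
by apply: (gunit_inj (gG := gG)); rewrite -su -vz quot_tiota.
Qed.

(** That [quot] preserves units is derived: the image of a unit is an idempotent loop, so
    [gmul_inj_unit] applies. *)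
Lemma quot_gunit u : quot T (gunit T u) = gunit gG u.
Proof.
have uu : gmul T (gunit T u) (gunit T u) = gunit T u.
  by have := mul_unitl (gS T) (gunit T u); rewrite rng_unit.
have := @gmul_inj_unit _ _ gG (quot T (gunit T u)).
rewrite src_quot rng_quot src_unit rng_unit; apply=> //.
by rewrite -quot_mul ?src_unit ?rng_unit// uu.
Qed.

Lemma quot_unit_src u s : quot T s = gunit gG u -> src T s = u.
Proof. by move=> su; rewrite -src_quot su src_unit. Qed.

Lemma quot_unit_rng u s : quot T s = gunit gG u -> rng T s = u.
Proof. by move=> su; rewrite -rng_quot su rng_unit. Qed.

(** The product of [quot T (ginv T s)] and [quot T s] is a unit, so if one factor is a unit, the
    other is too. *)
Lemma quot_inv_unit u s :
  quot T (ginv T s) = gunit gG u <-> quot T s = gunit gG u.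
Proof.
have iss : gmul gG (quot T (ginv T s)) (quot T s) = gunit gG (src T s).
  by rewrite -quot_mul ?src_inv// inv_mul quot_gunit.
split=> su.
  have rs := quot_unit_src su; rewrite src_inv in rs.
  have ss := quot_unit_rng su; rewrite rng_inv in ss.
  have uE : gunit gG u = gunit gG (rng gG (quot T s)) by rewrite rng_quot rs.
  by move: iss; rewrite su ss {1}uE mul_unitl.
have rs := quot_unit_rng su; have ss := quot_unit_src su.
have uE : gunit gG u = gunit gG (src gG (quot T (ginv T s))).
  by rewrite src_quot src_inv rs.
by move: iss; rewrite su ss {1}uE mul_unitr.
Qed.

Lemma rng_act z s : rng T (act T z s) = rng T s.
Proof. by rewrite /act rng_mul ?rng_iota ?src_iota. Qed.

Lemma quot_act z s : quot T (act T z s) = quot T s.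
Proof.
rewrite /act quot_mul ?src_iota// quot_tiota.
by rewrite -(rng_quot T) mul_unitl.
Qed.

Lemma quot_rep x : quot T (rep T x) = x.
Proof. by rewrite /rep; case: cid. Qed.

(** The fibres of [quot] are circle orbits: [t^-1 s] lies over a unit, hence comes from [tiota], and
    centrality moves it to the left of [t]. *)
Lemma quot_eq_act s t : quot T s = quot T t ->
  exists w, gmul T (ginv T t) s = tiota T (src T s, w) /\ s = act T w t.
Proof.
move=> st.
have rst : rng T s = rng T t by rewrite -!rng_quot st.
have sst : src T s = src T t by rewrite -!src_quot st.
have qu : quot T (gmul T (ginv T t) s) = gunit gG (src T s).
  by rewrite quot_mul ?src_inv// st -quot_mul ?src_inv// inv_mul quot_gunit sst.
have [w wE] := quot_unit_tiota qu; exists w; split=> //.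
by rewrite /act iota_central -sst -wE gmulKV.
Qed.

(* Since [iota] trivialises the bundle over the units, this is the indicator
   function of [u], extended by 0 to [Sigma]. *)
Definition bump u s : R[i] :=
  xget 0 [set val z | z in [set z | s = tiota T (u, z)]].

Lemma bump_tiota u z : bump u (tiota T (u, z)) = val z.
Proof.
rewrite /bump; case: xgetP => [x -> [w /= /tiota_inj[->] //]|/(_ (val z)) nz].
by case: nz; exists z.
Qed.

Lemma bump_out u s : quot T s <> gunit gG u -> bump u s = 0.
Proof.
move=> su; rewrite /bump; case: xgetP => [x _ [w /= sE]|//].
by case: su; rewrite sE quot_tiota.
Qed.

Lemma bump_neq0 u s : (bump u s != 0) = (quot T s == gunit gG u).
Proof.
have [/quot_unit_tiota[z ->]|/eqP/bump_out->] := eqVneq (quot T s) _; last first.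
  by rewrite eqxx.
rewrite bump_tiota -normr_eq0; have -> : `|val z| = 1 by exact: set_mem (valP z).
by rewrite oner_eq0.
Qed.

Lemma bump_equivariant u : equivariant T (bump u).
Proof.
move=> z s; have [su|su] := pselect (quot T s = gunit gG u).
  have [w ->] := quot_unit_tiota su.
  by rewrite /act rng_iota -iota_mul !bump_tiota.
by rewrite !bump_out ?mulr0// quot_act.
Qed.

(** Over [u], inversion in [Sigma] is inversion in the circle, which is complex conjugation. *)
Lemma invol_bump u : invol T (bump u) = bump u.
Proof.
apply/funext => s; rewrite /invol.
have [su|su] := pselect (quot T s = gunit gG u); last first.
  by rewrite !bump_out ?conjC0// quot_inv_unit.
have [w wE] := quot_unit_tiota su.
have [z zE] := quot_unit_tiota ((quot_inv_unit u s).2 su).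
(* That [tiota] sends 1 to the unit is derived: the unit is [tiota T (u, e)] for some [e], and
   [e = e * e] forces [val e = 1]. *)
have [e eE] := quot_unit_tiota (quot_gunit u).
have ee : e = circle_mul e e.
  have := mul_unitl T (gunit T u); rewrite rng_unit eE -iota_mul.
  by move/tiota_inj => -[].
have zw : circle_mul z w = e.
  have : gmul T (tiota T (u, z)) (tiota T (u, w)) = tiota T (u, e).
    by rewrite -zE -wE inv_mul (quot_unit_src su) eE.
  by rewrite -iota_mul => /tiota_inj[].
have val_norm (y : circle R) : `|val y| = 1 by exact: set_mem (valP y).
have e1 : val e = 1.
  have e0 : val e != 0 by rewrite -normr_eq0 val_norm oner_eq0.
  by apply: (mulfI e0); rewrite mulr1 {3}ee.
have zw1 : val z * val w = 1 by rewrite -e1 -zw.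
rewrite zE wE !bump_tiota -[LHS]mulr1 -zw1 mulrA (mulrC _ (val z)) -normCK.
by rewrite val_norm expr1n mul1r.
Qed.

(** Only the term at [gunit gG u] can survive. Its representative is [tiota T (u, z)] for an unknown
    phase [z], which the equivariance of [f] absorbs. *)
Lemma convol_bumpl u f : equivariant T f ->
  convol T (bump u) f = f \_ (rng T @^-1` [set u]).
Proof.
move=> f_equiv; apply/funext => s; rewrite /convol.
have [su|su] := pselect (rng T s = u); last first.
  rewrite fsbig1 ?/patch ?memNset// => x /= xs; apply/eqP.
  rewrite mulf_eq0; apply/orP; left; apply/eqP/bump_out; rewrite quot_rep => xu.
  by apply: su; rewrite -xs xu rng_unit.
rewrite -(fsbig_widen [set gunit gG u]); first last.
- move=> x /= [_ xu]; rewrite bump_out ?mul0r// quot_rep; exact: xu.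
- by move=> _ ->; rewrite /= rng_unit.
rewrite fsbig_set1 /patch mem_set//.
have [z zE] := quot_unit_tiota (quot_rep (gunit gG u)).
rewrite zE bump_tiota -f_equiv /act rng_mul ?rng_inv ?src_inv ?rng_iota ?src_iota//.
by rewrite gmulKV// rng_iota.
Qed.

(** A nonzero factor [bump u] puts [s] in the circle orbit of [rep T x], so only the term at
    [quot T s] can survive. *)
Lemma convol_bumpr u f : equivariant T f ->
  convol T f (bump u) = f \_ (src T @^-1` [set u]).
Proof.
move=> f_equiv; apply/funext => s; rewrite /convol.
rewrite -(fsbig_widen [set quot T s]); first last.
- move=> x /= [xs xqs]; rewrite bump_out ?mulr0// => xsu; apply: xqs => /=.
  have rs : rng T (rep T x) = rng T s by rewrite -(rng_quot T) quot_rep xs.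
  have [w wE] := quot_unit_tiota xsu.
  have ru : src T (rep T x) = u.
    by have := rng_iota T u w; rewrite -wE rng_mul ?src_inv// rng_inv.
  have : s = act T w (rep T x).
    by rewrite /act iota_central ru -wE gmulKV.
  by move=> {1}->; rewrite quot_act quot_rep.
- by move=> _ ->; rewrite /= rng_quot.
rewrite fsbig_set1; have [w [wE sE]] := quot_eq_act (esym (quot_rep (quot T s))).
rewrite wE; have [su|su] := pselect (src T s = u).
  by rewrite /patch mem_set// su bump_tiota mulrC {2}sE f_equiv.
rewrite /patch memNset// bump_out ?mulr0// quot_tiota => /gunit_inj.
exact: su.
Qed.

Lemma bump_mul u : convol T (bump u) (bump u) = bump u.
Proof.
rewrite convol_bumpl; last exact: bump_equivariant.
apply/funext => s; rewrite /patch; case: ifPn => // /negP su.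
rewrite bump_out// => /quot_unit_rng us; apply: su; exact: mem_set.
Qed.

Lemma bump_orthogonal u v : u <> v -> convol T (bump u) (bump v) = 0.
Proof.
move=> uv; rewrite convol_bumpl; last exact: bump_equivariant.
apply/funext => s; rewrite /patch; case: ifPn => // /set_mem /= su.
by rewrite bump_out// => /quot_unit_rng sv; apply: uv; rewrite -su -sv.
Qed.

Lemma bump_l2norm u : l2norm T u (bump u) = 1%E.
Proof.
rewrite /l2norm (_ : \esum_(x in _) _ = 1%E); first by rewrite /= sqrtr1.
rewrite (esumID [set gunit gG u]); last by move=> x _; rewrite lee_fin sqr_ge0.
rewrite [X in (_ + X)%E]esum1 ?adde0; last first.
  move=> x [_ /= xu]; rewrite bump_out ?quot_rep//.
  by rewrite (_ : rnorm 0 = 0) ?expr0n//; apply/eqP; rewrite rnorm_eq0.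
rewrite (_ : _ `&` _ = [set gunit gG u]); last first.
  by apply/seteqP; split=> [x []//|_ ->]; split=> //=; rewrite src_unit.
rewrite esum_set1 ?lee_fin ?sqr_ge0//.
have [z ->] := quot_unit_tiota (quot_rep (gunit gG u)).
by rewrite bump_tiota /rnorm (set_mem (valP z)) expr1n.
Qed.

(** The unit vector [bump u] of [l2 T u] is fixed by convolution with [bump u]. The bound serves to
    show that the image of [bump u] in the completion is nonzero. *)
Lemma bump_reduced_norm u : (1 <= reduced_norm T (bump u))%E.
Proof.
rewrite /reduced_norm le_max; apply/orP; right.
apply: (@le_trans _ _ (l2_opnorm T u (regular_rep T u (bump u)))); last first.
  by apply: ereal_sup_ubound; exists u.
rewrite -[X in (X <= _)%E](bump_l2norm u); apply: ereal_sup_ubound.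
exists (bump u); last by rewrite /regular_rep bump_mul.
split; last by rewrite /= bump_l2norm.
split; [|exact: bump_equivariant|by rewrite bump_l2norm ltry].
by move=> s su; apply: bump_out => /quot_unit_src.
Qed.

End Bump.

(** * Isolated units: membership of the indicators in [Cc], and the column bound *)

Section IsolatedUnits.
Variables (R : realType) (U G Sigma : topologicalType) (gG : topGroupoid U G).
Variable T : twist R Sigma gG.
Hypotheses (G_hausdorff : hausdorff_space G) (G_etale : etale gG).
Implicit Types (u : U) (f : Sigma -> R[i]).

Lemma closed_arrow (x : G) : closed [set x].
Proof. by apply: accessible_closed_set1; exact: hausdorff_accessible. Qed.

(** Points of [U] inherit closedness from [G] through the continuous injection [gunit]. *)
Lemma closed_unit u : closed [set u].
Proof.
rewrite (_ : [set u] = gunit gG @^-1` [set gunit gG u]).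
  by apply: preimage_closed => [v _|]; [exact: unit_continuous|exact: closed_arrow].
by apply/seteqP; split=> [_ ->//|v /gunit_inj].
Qed.

(** The range map is injective on an open neighbourhood of [gunit gG u], so this unit is the only
    arrow there with range [u]. *)
Lemma open_isolated_unit u : open [set u] -> open [set gunit gG u].
Proof.
move=> ou; have [B [oB Bu _ [_ rng_inj _ _]]] := G_etale.1 (gunit gG u).
rewrite (_ : [set gunit gG u] = B `&` rng gG @^-1` [set u]).
  by apply: openI => //; apply: open_comp ou => x _; exact: rng_continuous.
apply/seteqP; split=> [_ ->|x [Bx xu]]; first by split=> //=; rewrite rng_unit.
have := rng_inj (exist _ x (mem_set Bx)) (exist _ (gunit gG u) (mem_set Bu)).
by rewrite /= rng_unit => /(_ xu)[].
Qed.

Lemma bump_continuous u : open [set u] -> continuous (bump T u).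
Proof.
move=> ou; set E := quot T @^-1` [set gunit gG u].
have oE : open E.
  apply: open_comp (open_isolated_unit ou) => s _; exact: quot_continuous.
have cE : closed E.
  by apply: preimage_closed => [s _|]; [exact: quot_continuous|exact: closed_arrow].
rewrite (_ : bump T u = bump T u \_ E); last first.
  apply/funext => s; rewrite /patch; case: ifPn => // /negP Es.
  by apply: bump_out => su; apply: Es; exact: mem_set.
apply: patch0_continuous => // s /set_mem Es N.
rewrite nbhsE => -[V [oV Vs] VN].
(* Within [E], the preimage of [V] is the image under [tiota] of [u] paired with the circle elements
   in [V]. It is relatively open because [tiota] is a homeomorphism onto its range and [u] is
   isolated. *)
have [_ _ iotaE iota_open] := iota_homeo T.
have [|W oW imW] := iota_open ([set u] `*` (val @^-1` V)).
  by apply: open_setX => //; exists V.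
apply: filterS (open_nbhs_nbhs (conj (openI oW oE) _)).
  move=> t [Wt Et]; apply: VN.
  have : (tiota T @` ([set u] `*` (val @^-1` V))) t.
    by rewrite imW; split=> //; exists u.
  by move=> [[_ z] [/= -> Vz] <-]; rewrite bump_tiota.
split=> //; have [z zE] := quot_unit_tiota Es.
have : (tiota T @` ([set u] `*` (val @^-1` V))) s.
  by exists (u, z) => //; split=> //=; rewrite -(bump_tiota T u) -zE.
by rewrite imW => -[].
Qed.

(** The support is the image under [tiota] of one copy of the circle. *)
Lemma bump_Cc u : open [set u] -> Cc T (bump T u).
Proof.
move=> ou; split; [exact: bump_continuous| |exact: bump_equivariant].
set E := quot T @^-1` [set gunit gG u].
have cE : closed E.
  by apply: preimage_closed => [s _|]; [exact: quot_continuous|exact: closed_arrow].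
rewrite (_ : [set s | _] = E); last first.
  by apply/seteqP; split=> s /=; rewrite bump_neq0 => /eqP.
rewrite -(closure_id E).1//.
rewrite (_ : E = tiota T @` ([set u] `*` setT)); last first.
  apply/seteqP; split=> [s /quot_unit_tiota[z ->]|_ [[_ z] [/= -> _] <-]].
    by exists (u, z).
  exact: quot_tiota.
apply: continuous_compact; last first.
  by apply: compact_setX; [exact: compact_set1|exact/compact_setT_type/circle_compact].
by apply: continuous_subspaceT; have [] := iota_homeo T.
Qed.

Lemma Cc_patch f (A : set Sigma) : Cc T f -> open A -> closed A ->
  (forall z s, A (act T z s) <-> A s) -> Cc T (f \_ A).
Proof.
move=> [f_cont f_compact f_equiv] oA cA actA; split.
- by apply: patch0_continuous => // s _; exact: f_cont.
- apply: subclosed_compact f_compact _; first exact: closed_closure.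
  by apply: closureS => s /=; rewrite /patch; case: ifP => //; rewrite eqxx.
- move=> z s; rewrite /patch; have [As|As] := pselect (A s).
    by rewrite !mem_set//; exact/actA.
  by rewrite !memNset ?mulr0// => /actA.
Qed.

(** Finitely many open sets on which [src] is injective cover the compact image of the support in
    [G], and [k] is their number. Each contains at most one arrow with source [v], so it accounts
    for at most one [u] in [r]. *)
Lemma Cc_column_bound f : Cc T f ->
  exists k, forall (v : U) (r : seq U), uniq r ->
    (forall u, u \in r -> exists s, [/\ f s != 0, rng T s = u & src T s = v]) ->
    (size r <= k)%N.
Proof.
move=> [_ f_compact _]; set K := closure _ in f_compact.
have K_compact : compact (quot T @` K).
  apply: continuous_compact f_compact; apply: continuous_subspaceT.
  exact: quot_continuous.
have bisection x : exists B : set G, [/\ open B, B x &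
    forall y z, B y -> B z -> src gG y = src gG z -> y = z].
  have [B [oB Bx _ [_ src_inj _ _]]] := G_etale.2 x; exists B.
  split=> // y z By Bz yz.
  have := src_inj (exist _ y (mem_set By)) (exist _ z (mem_set Bz)).
  by move=> /(_ yz)[].
have [B BP] := choice bisection.
have [||c cP] := @compact_finite_subcover _ _ B K_compact.
- by move=> x; have [] := BP x.
- by move=> x; have [] := BP x.
exists (size c) => v r r_uniq rP.
(* The implication makes the statement total, as [choice] requires; outside [r] the value
   [gunit gG v] is a placeholder. *)
have center u : exists y, u \in r -> y \in c /\
    exists2 s, B y (quot T s) & rng T s = u /\ src T s = v.
  have [/rP[s [fs su sv]]|_] := boolP (u \in r); last first.
    by exists (gunit gG v).
  have [|y yc Bys] := cP (quot T s).
    by exists s => //; exact: subset_closure.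
  by exists y => _; split=> //; exists s.
have [y yP] := choice center.
rewrite -(size_map y); apply: uniq_leq_size; last first.
  by move=> _ /mapP[u ur ->]; have [] := yP u ur.
rewrite map_inj_in_uniq// => u u' ur u'r yuu'.
have [_ [s Bs [su sv]]] := yP u ur; have [_ [s' Bs' [su' sv']]] := yP u' u'r.
have [_ _ B_inj] := BP (y u).
have ss' : quot T s = quot T s'.
  by apply: B_inj => //; [rewrite yuu'|rewrite !src_quot sv sv'].
by rewrite -su -su' -!(rng_quot T) ss'.
Qed.

End IsolatedUnits.

(** * Separation of units, and the contradiction *)

(** A locally compact Hausdorff space is completely regular; the separating function on [G] is
    pulled back along [gunit]. *)
Lemma locally_compact_separated (R : realType) (U G : topologicalType)
    (gG : topGroupoid U G) :
  locally_compact [set: G] -> hausdorff_space G -> forall u v : U, u <> v ->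
  exists g : U -> R,
    [/\ continuous g, forall w, 0 <= g w <= 1, g u = 0 & g v = 1].
Proof.
move=> G_lc G_hausdorff u v uv.
have : uniform_separator [set gunit gG u] [set gunit gG v].
  apply: (@locally_compact_completely_regular _ R) => //=.
    exact: closed_arrow.
  by move/gunit_inj.
move=> /(uniform_separatorP (R := R))[g [g_cont g01 gu gv]].
exists (g \o gunit gG); split.
- move=> w; apply: continuous_comp; first exact: unit_continuous.
  exact: g_cont.
- move=> w; have /g01 : range g ((g \o gunit gG) w) by exists (gunit gG w).
  by rewrite /= in_itv.
- by apply: gu; exists (gunit gG u).
- by apply: gv; exists (gunit gG v).
Qed.

Theorem theorem4p1 (R : realType)
  (H : completeNormedModType R[i]) (dot : {dot H for Num.conj})
  (H_hilbert : hilbert_dot dot)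
  (H_infinite : infinite_dimensional H)
  (U G Sigma : topologicalType) (gG : topGroupoid U G)
  (G_locally_compact : locally_compact [set: G])
  (G_hausdorff : hausdorff_space G)
  (G_etale : etale gG)
  (T : twist R Sigma gG)
  (X : Type) (X_infinite : infinite_set [set: X])
  (C0_ell_infty : star_isomorphic (C0 R U) (ell_infty R X))
  (A : cstarAlgType R) (j : (Sigma -> R[i]) -> A)
  (A_reduced : is_reduced_cstar T j) :
  ~ star_isomorphic (cstar_starAlg A) (BH dot).
Proof.
move=> [phi phi_iso]; have [psi psi_iso] := C0_ell_infty.
have U_separated := locally_compact_separated R gG G_locally_compact G_hausdorff.
have [u u_inj ou] := isolated_sequence U_separated psi_iso X_infinite.
have [[_ jZ] jM j_star j_norm j_dense] := A_reduced.
pose p n := bump T (u n).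
have p_Cc n : Cc T (p n) by exact: bump_Cc.
have p_equiv n : equivariant T (p n) by exact: bump_equivariant.
(* [j] is known to be linear only on [Cc T], so 0 is written as a multiple of an element of
   [Cc T]. *)
have j0 : j 0 = 0.
  by rewrite -(scale0r (p 0%N)) jZ ?scale0r//; exact/mem_set.
apply: (no_dense_band H_hilbert phi_iso (p := j \o p)) j_dense _.
- by move=> n; rewrite /= -jM ?bump_mul//; exact/mem_set.
- by move=> n; rewrite /= -j_star ?invol_bump//; exact/mem_set.
- move=> m n mn; rewrite /= -jM ?bump_orthogonal//; try exact/mem_set.
  by move/u_inj/eqP; rewrite (negPf mn).
- move=> n; apply/eqP => jp0; have := j_norm _ (mem_set (p_Cc n)).
  move=> /= jpE; have := bump_reduced_norm T (u n); rewrite -jpE.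
  have -> : rnorm (j (p n)) = 0 by apply/eqP; rewrite rnorm_eq0; exact/eqP.
  by rewrite lee_fin ler10.
- move=> _ [f f_Cc <-]; have [k kP] := Cc_column_bound G_etale f_Cc.
  have f_equiv : equivariant T f by have [] := f_Cc.
  have rng_clopen n : open (rng T @^-1` [set u n]) /\ closed (rng T @^-1` [set u n]).
    split.
      by apply: open_comp (ou n) => s _; exact: rng_continuous.
    apply: preimage_closed; last exact: closed_unit gG G_hausdorff _.
    by move=> s _; exact: rng_continuous.
  have pf_Cc m : Cc T (f \_ (rng T @^-1` [set u m])).
    have [oru cru] := rng_clopen m; apply: Cc_patch => // z s.
    by rewrite /preimage/= rng_act.
  exists k => n r r_uniq rP; rewrite -(size_map u); apply: (kP (u n)).
    by rewrite map_inj_uniq.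
  (* The corner is [f] restricted to arrows of [Sigma] with range [u m] and source [u n]. If [f]
     vanishes on all of them, the corner is [j 0]. *)
  move=> _ /mapP[m mr ->]; apply: contrapT => no_arrow.
  case/eqP: (rP m mr); rewrite /= -jM ?convol_bumpl//; try exact/mem_set.
  rewrite -jM ?convol_bumpr//; try exact/mem_set; last by have [] := pf_Cc m.
  rewrite -j0; congr j; apply/funext => s; rewrite /patch.
  case: ifP => // /set_mem /= sn; case: ifP => // /set_mem /= sm.
  by apply/eqP; apply: contrapT => /negP fs; apply: no_arrow; exists s.
Qed.
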